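(* Let $(M,\omega)$ be a symplectic manifold with a smooth action of a Lie group $G$ with Lie algebra $\mathfrak g$, and let $\rho:M\times\mathfrak g\to TM$ be the induced infinitesimal action. Let $\mu:M\to\mathfrak g^*$ be a momentum map. Regarded as a section $\mu\in\Gamma(M\times\mathfrak g^* )=\Gamma(E^* )$, where $E=M\times\mathfrak g$ is the action Lie algebroid of the action, $\mu$ is a compatible $E$-$1$-form with respect to $\omega$, that is, $${}^E\mathrm{d}\mu=-\iota_\rho^2\omega .$$
   Context: The infinitesimal action is a Lie algebra homomorphism $\rho:\mathfrak g\to\mathfrak X(M)$, $[\rho(e_1),\rho(e_2)]=\rho([e_1,e_2])$. A momentum map is a map $\mu:M\to\mathfrak g^*$ satisfying, for all $e,e_1,e_2\in\mathfrak g$, $\mathrm{d}\mu(e)=-\iota_{\rho(e)}\omega$ and $\rho(e_1)\langle\mu,e_2\rangle=\langle\mu,[e_1,e_2]\rangle$, where $\langle-,-\rangle$ is the pairing of $\mathfrak g^*$ and $\mathfrak g$. The action Lie algebroid is the trivial bundle $E=M\times\mathfrak g$ with anchor $\rho$ and the bracket on $\Gamma(E)$ that extends the bracket of $\mathfrak g$ on constant sections by the Leibniz rule $[e_1,fe_2]=f[e_1,e_2]+(\rho(e_1)f)e_2$. For $\alpha\in\Gamma(E^* )$, the Lie algebroid differential is ${}^E\mathrm{d}\alpha(e_1,e_2)=\rho(e_1)\alpha(e_2)-\rho(e_2)\alpha(e_1)-\alpha([e_1,e_2])$. $\iota_\rho^2\omega\in\Gamma(\wedge^2E^* )$ is defined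 by $\iota_\rho^2\omega(e_1,e_2)=\iota_{\rho(e_1)}\iota_{\rho(e_2)}\omega=\omega(\rho(e_2),\rho(e_1))$. In general, for a closed $(n+1)$-form $\omega$ on $M$, $J\in\Gamma(\wedge^nE^* )$ is a compatible $E$-$n$-form if ${}^E\mathrm{d}J=-\iota_\rho^{n+1}\omega$, where $\iota_\rho^{n+1}\omega(e_1,\dots,e_{n+1})=\iota_{\rho(e_1)}\cdots\iota_{\rho(e_{n+1})}\omega$. *)

(* Defs.v *)
From HB Require Import structures.
From mathcomp Require Import all_boot all_order all_algebra.
From mathcomp Require Import all_classical all_reals all_analysis.

Set Implicit Arguments.
Unset Strict Implicit.
Unset Printing Implicit Defensive.

Import Order.TTheory GRing.Theory Num.Theory.
Import numFieldNormedType.Exports.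

Local Open Scope classical_set_scope.
Local Open Scope ring_scope.

(* Used only with U open; f is unconstrained outside U. *)
Fixpoint Ck_on (R : realType) (n : nat) (W : normedModType R) (k : nat)
    (U : set 'rV[R]_n) (f : 'rV[R]_n -> W) : Prop :=
  (forall p, U p -> {for p, continuous f}) /\
  if k is k'.+1 then
    forall v : 'rV[R]_n,
      (forall p, U p -> derivable f p v) /\ Ck_on k' U (fun p => 'D_v f p)
  else True.

Definition smooth_on (R : realType) (n : nat) (W : normedModType R)
    (U : set 'rV[R]_n) (f : 'rV[R]_n -> W) : Prop :=
  forall k, Ck_on k U f.

(* [chart_map] and [chart_inv] are total functions; they are mutually inverse
   homeomorphisms between [chart_dom] and [chart_cod] and carry no information
   elsewhere. *)
Record chart (R : realType) (n : nat) (M : topologicalType) := Chart {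
  chart_dom : set M;
  chart_cod : set 'rV[R]_n;
  chart_map :> M -> 'rV[R]_n;
  chart_inv : 'rV[R]_n -> M;
  chart_dom_open : open chart_dom;
  chart_cod_open : open chart_cod;
  chart_map_cod : forall x, chart_dom x -> chart_cod (chart_map x);
  chart_inv_dom : forall p, chart_cod p -> chart_dom (chart_inv p);
  chart_mapK : forall x, chart_dom x -> chart_inv (chart_map x) = x;
  chart_invK : forall p, chart_cod p -> chart_map (chart_inv p) = p;
  chart_map_continuous : forall x, chart_dom x -> {for x, continuous chart_map};
  chart_inv_continuous : forall p, chart_cod p -> {for p, continuous chart_inv}
}.

HB.mixin Record isManifold (R : realType) (n : nat) M of Topological M := {
  manifold_hausdorff : hausdorff_space M;
  manifold_second_countable : @second_countable M;
  atlas : set (chart R n M);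
  atlas_cover : forall x : M, exists2 c, atlas c & chart_dom c x;
  atlas_compatible : forall c d, atlas c -> atlas d ->
    smooth_on (chart_cod c `&` chart_inv c @^-1` chart_dom d)
              (d \o chart_inv c)
}.

#[short(type="manifoldType")]
HB.structure Definition Manifold (R : realType) (n : nat) :=
  {M of Topological M & isManifold R n M}.

Definition smooth_fun (R : realType) (m : nat) (M : manifoldType R m)
    (W : normedModType R) (f : M -> W) : Prop :=
  forall c : chart R m M, atlas c ->
    smooth_on (chart_cod c) (f \o chart_inv c).

(* Smoothness of f : M x N -> P for the product manifold M x N, whose atlas
   consists of the products of charts; R^m x R^n is 'rV_(m + n). *)
Definition smooth_map2 (R : realType) (m n p : nat) (M : manifoldType R m)
    (N : manifoldType R n) (P : manifoldType R p) (f : M -> N -> P) : Prop :=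
  continuous (fun z : M * N => f z.1 z.2) /\
  forall (c : chart R m M) (d : chart R n N) (e : chart R p P),
    atlas c -> atlas d -> atlas e ->
    let F (q : 'rV[R]_(m + n)) :=
      f (chart_inv c (lsubmx q)) (chart_inv d (rsubmx q)) in
    smooth_on [set q | [/\ chart_cod c (lsubmx q), chart_cod d (rsubmx q)
                         & chart_dom e (F q)]] (e \o F).

Definition smooth_map (R : realType) (m n : nat) (M : manifoldType R m)
    (N : manifoldType R n) (f : M -> N) : Prop :=
  continuous f /\
  forall (c : chart R m M) (d : chart R n N), atlas c -> atlas d ->
    smooth_on (chart_cod c `&` (f \o chart_inv c) @^-1` chart_dom d)
              (d \o f \o chart_inv c).

Definition chart_at (R : realType) (m : nat) (M : manifoldType R m) (x : M) :
    chart R m M :=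
  projT1 (cid2 (atlas_cover x)).

(* A tangent vector at x is given by its components in the chart
   [chart_at x]. *)
Definition tangent (R : realType) (m : nat) (M : manifoldType R m) (x : M) :
    normedModType R :=
  'rV[R]_m.

(* v f, the derivative of f at x along the tangent vector v. *)
Definition mderive (R : realType) (m : nat) (M : manifoldType R m)
    (W : normedModType R) (f : M -> W) (x : M) (v : tangent x) : W :=
  'D_(v : 'rV[R]_m) (f \o chart_inv (chart_at x)) (chart_at x x).
Arguments mderive {R m M W} f x v.

Definition tangent_map (R : realType) (m n : nat) (M : manifoldType R m)
    (N : manifoldType R n) (f : M -> N) (x : M) (v : tangent x) :
    tangent (f x) :=
  mderive (chart_at (f x) \o f) x v.
Arguments tangent_map {R m n M N} f x v.

Definition vector_field (R : realType) (m : nat) (M : manifoldType R m) :=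
  forall x : M, tangent x.

(* The components of [X, Y] in a chart (x^1, ..., x^m) at x are
   X(Y x^i) - Y(X x^i). *)
Definition lie_bracket (R : realType) (m : nat) (M : manifoldType R m)
    (X Y : vector_field M) : vector_field M :=
  fun x =>
    mderive (fun y => mderive (chart_at x) y (Y y)) x (X x) -
    mderive (fun y => mderive (chart_at x) y (X y)) x (Y x).

(* The vector field on the domain of c whose components in c are u. *)
Definition coord_field (R : realType) (m : nat) (M : manifoldType R m)
    (c : chart R m M) (u : 'rV[R]_m) : vector_field M :=
  fun x => 'D_u (chart_at x \o chart_inv c) (c x).

Definition form2 (R : realType) (m : nat) (M : manifoldType R m) :=
  forall x : M, tangent x -> tangent x -> R.

Definition is_form2 (R : realType) (m : nat) (M : manifoldType R m)
    (omega : form2 M) : Prop :=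
  [/\ forall (x : M) (u : tangent x), scalar (omega x u),
      forall (x : M) (v : tangent x), scalar (omega x ^~ v),
      forall (x : M) (v : tangent x), omega x v v = 0 &
      forall (c : chart R m M) (u v : 'rV[R]_m), atlas c ->
        smooth_on (chart_cod c)
          ((fun x => omega x (coord_field c u x) (coord_field c v x) : R^o)
             \o chart_inv c)].

(* Since coordinate fields commute, the formula for d omega has no bracket
   terms. *)
Definition ext_derive2 (R : realType) (m : nat) (M : manifoldType R m)
    (omega : form2 M) (x : M) (u v w : tangent x) : R :=
  let comp (a b : 'rV[R]_m) : M -> R^o := fun y =>
    omega y (coord_field (chart_at x) a y) (coord_field (chart_at x) b y) in
  mderive (comp v w) x u + mderive (comp w u) x v + mderive (comp u v) x w.

Definition symplectic (R : realType) (m : nat) (M : manifoldType R m)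
    (omega : form2 M) : Prop :=
  [/\ is_form2 omega,
      forall (x : M) (u v w : tangent x), ext_derive2 omega u v w = 0 &
      forall (x : M) (u : tangent x),
        (forall v : tangent x, omega x u v = 0) -> u = 0].

HB.mixin Record isLieGroup (R : realType) (k : nat) G
    of Manifold R k G & Group G := {
  mulg_smooth : smooth_map2 (fun g h : G => (g * h)%g);
  invg_smooth : smooth_map (fun g : G => (g^-1)%g)
}.

#[short(type="lieGroupType")]
HB.structure Definition LieGroup (R : realType) (k : nat) :=
  {G of Manifold R k G & Group G & isLieGroup R k G}.

Definition lie_algebra (R : realType) (k : nat) (G : lieGroupType R k) :
    normedModType R :=
  tangent (1%g : G).

(* [tangent (g * 1)] and [tangent g] are convertible types. *)
Definition left_invariant (R : realType) (k : nat) (G : lieGroupType R k)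
    (u : lie_algebra G) : vector_field G :=
  fun g => tangent_map (fun h : G => (g * h)%g) 1%g u.

Definition lie_algebra_bracket (R : realType) (k : nat) (G : lieGroupType R k)
    (u v : lie_algebra G) : lie_algebra G :=
  lie_bracket (left_invariant u) (left_invariant v) (1%g : G).

Definition smooth_action (R : realType) (m k : nat) (M : manifoldType R m)
    (G : lieGroupType R k) (act : G -> M -> M) : Prop :=
  [/\ smooth_map2 act,
      forall x, act 1%g x = x &
      forall g h x, act (g * h)%g x = act g (act h x)].

(* rho(e)_x = d/dt exp(- t e) x at t = 0. The sign makes e |-> rho(e) a
   homomorphism, and not an anti-homomorphism, for the bracket of
   left-invariant vector fields. *)
Definition infinitesimal_action (R : realType) (m k : nat)
    (M : manifoldType R m) (G : lieGroupType R k) (act : G -> M -> M)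
    (e : lie_algebra G) : vector_field M :=
  fun x => - (tangent_map (act ^~ x) 1%g e : tangent x).

(* For V finite-dimensional, smoothness of a map into the dual of V is that of
   its components. *)
Definition smooth_dual (R : realType) (m : nat) (M : manifoldType R m)
    (V : normedModType R) (mu : M -> {scalar V}) : Prop :=
  forall e : V, smooth_fun (fun x => mu x e : R^o).

Definition momentum_map (R : realType) (m k : nat) (M : manifoldType R m)
    (G : lieGroupType R k) (omega : form2 M) (act : G -> M -> M)
    (mu : M -> {scalar (lie_algebra G)}) : Prop :=
  let rho := infinitesimal_action act in
  [/\ smooth_dual mu,
      forall (e : lie_algebra G) (x : M) (v : tangent x),
        mderive (fun y => mu y e : R^o) x v = - omega x (rho e x) v &
      forall (e1 e2 : lie_algebra G) (x : M),
        mderive (fun y => mu y e2 : R^o) x (rho e1 x) =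
        mu x (lie_algebra_bracket e1 e2)].

(* Sections of E = M x g are the functions a : M -> g with [smooth_fun a]. *)
Definition anchor (R : realType) (m k : nat) (M : manifoldType R m)
    (G : lieGroupType R k) (act : G -> M -> M) (a : M -> lie_algebra G) :
    vector_field M :=
  fun x => infinitesimal_action act (a x) x.

(* E is trivial, so these conditions determine br on smooth sections, as
     br a b = [a, b] + rho(a) b - rho(b) a,
   and the Jacobi identity follows from them. *)
Record action_algebroid_bracket (R : realType) (m k : nat)
    (M : manifoldType R m) (G : lieGroupType R k) (act : G -> M -> M)
    (br : (M -> lie_algebra G) -> (M -> lie_algebra G) ->
          M -> lie_algebra G) : Prop := {
  algebroid_smooth : forall a b : M -> lie_algebra G,
    smooth_fun a -> smooth_fun b -> smooth_fun (br a b);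
  algebroid_add : forall a b c : M -> lie_algebra G,
    smooth_fun a -> smooth_fun b -> smooth_fun c ->
    br a (b \+ c) = br a b \+ br a c;
  algebroid_skew : forall a b : M -> lie_algebra G,
    smooth_fun a -> smooth_fun b -> br a b = \- br b a;
  algebroid_cst : forall u v : lie_algebra G,
    br (cst u) (cst v) = cst (lie_algebra_bracket u v);
  algebroid_leibniz : forall (f : M -> R^o) (a b : M -> lie_algebra G),
    smooth_fun f -> smooth_fun a -> smooth_fun b ->
    br a (fun x => f x *: b x) =
    (fun x => f x *: br a b x + mderive f x (anchor act a x) *: b x)
}.

Definition algebroid_diff1 (R : realType) (m k : nat) (M : manifoldType R m)
    (G : lieGroupType R k) (act : G -> M -> M)
    (br : (M -> lie_algebra G) -> (M -> lie_algebra G) -> M -> lie_algebra G)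
    (alpha : M -> {scalar (lie_algebra G)}) (a b : M -> lie_algebra G) (x : M) :
    R :=
  mderive (fun y => alpha y (b y) : R^o) x (anchor act a x) -
  mderive (fun y => alpha y (a y) : R^o) x (anchor act b x) -
  alpha x (br a b x).

Definition iota_rho2 (R : realType) (m k : nat) (M : manifoldType R m)
    (G : lieGroupType R k) (act : G -> M -> M) (omega : form2 M)
    (a b : M -> lie_algebra G) (x : M) : R :=
  omega x (anchor act b x) (anchor act a x).

Definition compatible_form1 (R : realType) (m k : nat) (M : manifoldType R m)
    (G : lieGroupType R k) (act : G -> M -> M)
    (br : (M -> lie_algebra G) -> (M -> lie_algebra G) -> M -> lie_algebra G)
    (omega : form2 M) (J : M -> {scalar (lie_algebra G)}) : Prop :=
  smooth_dual J /\
  forall a b : M -> lie_algebra G, smooth_fun a -> smooth_fun b ->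
    forall x, algebroid_diff1 act br J a b x = - iota_rho2 act omega a b x.

(* Main.v *)
From HB Require Import structures.
Require Import Defs.
From mathcomp Require Import all_boot all_order all_algebra.
From mathcomp Require Import all_classical all_reals all_analysis.
From mathcomp Require Import ring.

(** For constant sections u, v the claim is immediate: the differential of mu
    at (u, v) is
      rho(u)<mu, v> - rho(v)<mu, u> - <mu, [u, v]>,
    where equivariance makes the first term cancel the third, and the
    Hamiltonian condition makes the second one omega(rho(u), rho(v)).

    For sections a, b that vary, two first-order terms appear, and they cancel.
    Write D_w b for the componentwise derivative at x of b : M -> g along w.
    - The pairing has a product rule ([mderive_pairing]):
        w <mu, b> = w <mu, b(x)> + <mu(x), D_w b>,
      with b(x) read as a constant section.
    - The bracket differs from the one of the constant sections a(x), b(x) by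
      first-order terms ([action_algebroid_bracketE]):
        [a, b](x) = [a(x), b(x)] + D_(rho(a)) b - D_(rho(b)) a.
    In the differential of mu the terms <mu, D_(rho(a)) b> and
    <mu, D_(rho(b)) a> therefore drop out, and what remains is the constant
    case for a(x), b(x).

    Both formulas are instances of one principle ([first_order_operatorE]): an
    additive operator on maps b : M -> R^n obeying a Leibniz rule over
    functions sees b only through the value b(x) and one derivative of b. It is
    proved by expanding b in the standard basis. For the bracket the principle
    is applied in the second slot, then, after exchanging the slots by
    antisymmetry, in the first one. *)

Set Implicit Arguments.
Unset Strict Implicit.
Unset Printing Implicit Defensive.

Import Order.TTheory GRing.Theory Num.Theory.
Import numFieldNormedType.Exports.

Local Open Scope classical_set_scope.
Local Open Scope ring_scope.

(** * Smoothness and continuous linear maps *)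

Lemma is_derive_linear_comp (R : realType) (V W W' : normedModType R)
    (L : {linear W -> W'}) (f : V -> W) (p v : V) :
  continuous L -> derivable f p v ->
  is_derive p v (L \o f) (L ('D_v f p)).
Proof.
move=> cL df.
have cvgL : (fun h : R => h^-1 *: (((L \o f) \o shift p) (h *: v) - (L \o f) p))
    @ 0^' --> L ('D_v f p).
  rewrite (_ : (fun _ => _) = L \o
    (fun h : R => h^-1 *: ((f \o shift p) (h *: v) - f p))); last first.
    by apply/funext => h /=; rewrite -linearB -linearZ_LR.
  by apply: (@continuous_cvg _ _ _ _ _ _ L) => //; exact: cL.
by split; [apply/cvg_ex; eexists; exact: cvgL | exact: cvg_lim].
Qed.

(** Derivatives on an open set depend only on the values there. This is needed
    because the derivative of a composite is computed on U alone, whereas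
    [Ck_on] speaks of total functions. *)
Lemma Ck_on_eq (R : realType) (n : nat) (W : normedModType R) (k : nat)
    (U : set 'rV[R]_n) (f g : 'rV[R]_n -> W) :
  open U -> (forall p, U p -> f p = g p) -> Ck_on k U f -> Ck_on k U g.
Proof.
move=> oU.
have near_fg (f' g' : 'rV[R]_n -> W) p : (forall q, U q -> f' q = g' q) ->
    U p -> \near p, f' p = g' p.
  by move=> fg Up; apply: filterS (open_nbhs_nbhs (conj oU Up)) => q /fg.
have cont_fg (f' g' : 'rV[R]_n -> W) : (forall q, U q -> f' q = g' q) ->
    (forall p, U p -> {for p, continuous f'}) ->
    forall p, U p -> {for p, continuous g'}.
  move=> fg cf p Up; suff : g' @ p --> g' p by [].
  rewrite -(fg _ Up); apply: cvg_trans (cf p Up).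
  exact: (@near_eq_cvg _ _ (nbhs p) _ _ _ (near_fg _ _ _ fg Up)).
elim: k f g => [|k IH] f g fg /= [cf Df]; split; [exact: cont_fg cf | by []
  | exact: cont_fg cf | move=> v].
have [df CDf] := Df v; split=> [p Up|].
  by apply: near_eq_derivable (df p Up); exact: near_fg.
by apply: IH CDf => p Up; apply: near_eq_derive; exact: near_fg.
Qed.

Lemma Ck_on_linear_comp (R : realType) (n : nat) (W W' : normedModType R)
    (k : nat) (U : set 'rV[R]_n) (L : {linear W -> W'}) (f : 'rV[R]_n -> W) :
  open U -> continuous L -> Ck_on k U f -> Ck_on k U (L \o f).
Proof.
move=> oU cL.
have cont_comp (g : 'rV[R]_n -> W) :
    (forall p, U p -> {for p, continuous g}) ->
    forall p, U p -> {for p, continuous (L \o g)}.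
  by move=> cg p Up; apply: continuous_comp; [exact: cg | exact: cL].
elim: k f => [|k IH] f /= [cf Df]; split; [exact: cont_comp | by []
  | exact: cont_comp | move=> v].
have [df CDf] := Df v; have Ldf p Up := is_derive_linear_comp cL (df p Up).
split=> [p Up|]; first exact: (@ex_derive _ _ _ _ _ _ _ (Ldf p Up)).
apply: Ck_on_eq (IH _ CDf) => // p Up /=.
by rewrite (@derive_val _ _ _ _ _ _ _ (Ldf p Up)).
Qed.

Lemma Ck_on_cst (R : realType) (n : nat) (W : normedModType R) (k : nat)
    (U : set 'rV[R]_n) (w : W) : Ck_on k U (cst w).
Proof.
elim: k w => [|k IH] w /=; split=> [p Up|]; try exact: cst_continuous.
  by [].
move=> v; split=> [p Up|]; first exact: derivable_cst.
by rewrite (_ : (fun p => _) = cst 0) //; apply/funext => p; exact: derive_cst.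
Qed.

Lemma rV_linear_continuous (R : realType) (n : nat) (W : normedModType R)
    (L : {linear 'rV[R]_n -> W}) : continuous L.
Proof.
pose S (u : 'rV[R]_n) := \sum_(j < n) u ord0 j *: L (delta_mx ord0 j).
have SE : S = L.
  apply/funext => u; rewrite [in RHS](row_sum_delta u) linear_sum.
  by apply: eq_bigr => j _; rewrite linearZ.
suff : continuous S by rewrite SE.
apply: (continuous_big (op := +%R) add_continuous) => j _ u.
apply: (@continuous_comp _ _ _ (fun u : 'rV[R]_n => u ord0 j)
  (fun r : R => r *: L (delta_mx ord0 j))); first exact: coord_continuous.
exact: scalel_continuous.
Qed.

(** * Derivatives of smooth functions on a manifold *)

Section SmoothFunctions.
Context {R : realType} {m : nat} {M : manifoldType R m}.

Lemma chart_at_atlas (x : M) : atlas (chart_at x).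
Proof. by rewrite /chart_at; case: cid2. Qed.

Lemma chart_at_dom (x : M) : chart_dom (chart_at x) x.
Proof. by rewrite /chart_at; case: cid2. Qed.

Lemma chart_at_cod (x : M) : chart_cod (chart_at x) (chart_at x x).
Proof. exact/chart_map_cod/chart_at_dom. Qed.

Lemma chart_at_inv (x : M) : chart_inv (chart_at x) (chart_at x x) = x.
Proof. exact/chart_mapK/chart_at_dom. Qed.

Lemma smooth_fun_cst (W : normedModType R) (w : W) :
  smooth_fun (cst w : M -> W).
Proof. by move=> c _ k; exact: Ck_on_cst. Qed.

Lemma smooth_fun_linear_comp (W W' : normedModType R) (L : {linear W -> W'})
    (f : M -> W) :
  continuous L -> smooth_fun f -> smooth_fun (L \o f).
Proof.
move=> cL sf c Ac k; apply: (@Ck_on_linear_comp _ _ _ _ k _ L) => //.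
  exact: chart_cod_open.
exact: sf.
Qed.

Lemma smooth_fun_derivable (W : normedModType R) (f : M -> W) (x : M)
    (v : tangent x) :
  smooth_fun f ->
  derivable (f \o chart_inv (chart_at x)) (chart_at x x) (v : 'rV[R]_m).
Proof.
move=> sf; have [_ /(_ v) [df _]] := sf _ (chart_at_atlas x) 1%N.
exact/df/chart_at_cod.
Qed.

Lemma form2_skew (omega : form2 M) (x : M) (u v : tangent x) :
  is_form2 omega -> omega x u v = - omega x v u.
Proof.
move=> [omegar omegal omega_alt _].
have addr u' v' w' : omega x u' (v' + w') = omega x u' v' + omega x u' w'.
  by have := omegar x u' 1 v' w'; rewrite scale1r mul1r.
have addl u' v' w' : omega x (v' + w') u' = omega x v' u' + omega x w' u'.
  by have := omegal x u' 1 v' w'; rewrite scale1r mul1r.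
apply/eqP; rewrite -addr_eq0; apply/eqP.
have := omega_alt x (u + v).
by rewrite addr !addl !omega_alt add0r addr0 addrC.
Qed.

Lemma mderive_cst (W : normedModType R) (w : W) (x : M) (v : tangent x) :
  mderive (cst w) x v = 0.
Proof. exact: derive_cst. Qed.

Lemma mderive_linear_comp (W W' : normedModType R) (L : {linear W -> W'})
    (f : M -> W) (x : M) (v : tangent x) :
  continuous L -> smooth_fun f ->
  mderive (L \o f) x v = L (mderive f x v).
Proof.
move=> cL sf; have df := smooth_fun_derivable (v := v) sf.
exact: (@derive_val _ _ _ _ _ _ _ (is_derive_linear_comp cL df)).
Qed.

End SmoothFunctions.

(** * Operators obeying a Leibniz rule *)

Section FirstOrder.
Context {R : realType} {m n : nat} {M : manifoldType R m}.

Definition rV_coord (j : 'I_n) (u : 'rV[R]_n) : R^o := u ord0 j.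

Lemma rV_coord_linear j : linear (rV_coord j).
Proof. by move=> a u w; rewrite /rV_coord !mxE. Qed.

HB.instance Definition _ j :=
  GRing.isLinear.Build R _ _ _ _ (rV_coord_linear j).

Lemma smooth_coord (b : M -> 'rV[R]_n) (j : 'I_n) :
  smooth_fun b -> smooth_fun (fun y => b y ord0 j : R^o).
Proof.
exact/(smooth_fun_linear_comp (L := rV_coord j))/rV_linear_continuous.
Qed.

Lemma mderive_coord (b : M -> 'rV[R]_n) (j : 'I_n) (x : M) (v : tangent x) :
  smooth_fun b ->
  mderive (fun y => b y ord0 j : R^o) x v = mderive b x v ord0 j.
Proof.
exact/(mderive_linear_comp (L := rV_coord j))/rV_linear_continuous.
Qed.

(** The partial sums of the expansion of u in the standard basis. Being linear
    in u, they keep sections smooth, so additivity of an operator can be used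
    one basis vector at a time. *)
Definition coord_proj (s : seq 'I_n) (u : 'rV[R]_n) : 'rV[R]_n :=
  \sum_(j <- s) u ord0 j *: delta_mx ord0 j.

Lemma coord_proj_linear s : linear (coord_proj s).
Proof.
move=> a u w; rewrite /coord_proj scaler_sumr -big_split /=.
by apply: eq_bigr => j _; rewrite !mxE scalerDl scalerA.
Qed.

HB.instance Definition _ s :=
  GRing.isLinear.Build R _ _ _ _ (coord_proj_linear s).

(** Expand b as the sum of b_j e_j and apply additivity and the Leibniz rule:
      D b = sum_j (b_j(x) D e_j + (v b_j) symb e_j).
    The second part is symb (D_v b) by linearity; the first depends on b(x)
    only, and it is what the same formula gives for the constant map b(x), whose
    derivative vanishes. *)
Lemma first_order_operatorE (V : lmodType R) (D : (M -> 'rV[R]_n) -> V)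
    (symb : {linear 'rV[R]_n -> V}) (x : M) (v : tangent x) :
  (forall b c, smooth_fun b -> smooth_fun c -> D (b \+ c) = D b + D c) ->
  (forall (f : M -> R^o) (e : 'rV[R]_n), smooth_fun f ->
    D (fun y => f y *: e) = f x *: D (cst e) + mderive f x v *: symb e) ->
  forall b, smooth_fun b -> D b = D (cst (b x)) + symb (mderive b x v).
Proof.
move=> addD leibD.
have D0 : D (cst 0) = 0.
  have := addD _ _ (smooth_fun_cst 0) (smooth_fun_cst 0).
  rewrite (_ : _ \+ _ = cst 0); last by apply/funext => y /=; rewrite addr0.
  by move/(congr1 (fun z => z - D (cst 0))); rewrite addrK subrr.
have sproj s b : smooth_fun b -> smooth_fun (fun y => coord_proj s (b y)).
  by apply: (smooth_fun_linear_comp (L := coord_proj s));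
    exact: rV_linear_continuous.
have Dproj b : smooth_fun b -> forall s, D (fun y => coord_proj s (b y)) =
    \sum_(j <- s) b x ord0 j *: D (cst (delta_mx ord0 j)) +
    symb (coord_proj s (mderive b x v)).
  move=> sb; elim=> [|j s IH].
    rewrite /coord_proj !big_nil linear0 addr0 -[RHS]D0; congr D.
    by apply/funext => y; rewrite big_nil.
  rewrite (_ : (fun y => _) = (fun y => coord_proj [:: j] (b y)) \+
    (fun y => coord_proj s (b y))); last first.
    by apply/funext => y; rewrite /= /coord_proj big_cons big_seq1.
  rewrite addD; [|exact: sproj|exact: sproj].
  rewrite IH.
  rewrite (_ : (fun y => coord_proj [:: j] (b y)) =
    (fun y => b y ord0 j *: delta_mx ord0 j)); last first.
    by apply/funext => y; rewrite /coord_proj big_seq1.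
  rewrite leibD; last exact: smooth_coord.
  rewrite mderive_coord // /coord_proj !big_cons linearD linearZ /=.
  by rewrite addrACA.
have projT u : coord_proj (index_enum 'I_n) u = u.
  by rewrite /coord_proj -row_sum_delta.
have DE b : smooth_fun b -> D b =
    \sum_(j < n) b x ord0 j *: D (cst (delta_mx ord0 j)) +
    symb (mderive b x v).
  move=> /Dproj/(_ (index_enum 'I_n)); rewrite projT => <-; congr D.
  by apply/funext => y; rewrite projT.
move=> b sb; rewrite DE // [D (cst _)]DE; last exact: smooth_fun_cst.
by rewrite mderive_cst linear0 addr0.
Qed.

End FirstOrder.

(** * The action Lie algebroid *)

Section ActionAlgebroid.
Context {R : realType} {m k : nat} {M : manifoldType R m}
  {G : lieGroupType R k} {act : G -> M -> M}.

(** The operator b |-> v <mu, b> obeys the Leibniz rule with symbol mu(x). Its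
    additivity requires <mu, b> to be derivable, which is seen on components. *)
Lemma mderive_pairing (mu : M -> {scalar (lie_algebra G)})
    (b : M -> lie_algebra G) (x : M) (v : tangent x) :
  smooth_dual mu -> smooth_fun b ->
  mderive (fun y => mu y (b y) : R^o) x v =
  mderive (fun y => mu y (b x) : R^o) x v + mu x (mderive b x v).
Proof.
move=> smu sb.
have dmu (c : M -> lie_algebra G) : smooth_fun c ->
    derivable ((fun y => mu y (c y) : R^o) \o chart_inv (chart_at x))
      (chart_at x x) (v : 'rV[R]_m).
  move=> sc.
  rewrite (_ : _ \o _ = \sum_(j < k)
    ((fun y => (c y : 'rV[R]_k) ord0 j : R) \o chart_inv (chart_at x)) *
    ((fun y => mu y (delta_mx ord0 j : 'rV[R]_k) : R)
      \o chart_inv (chart_at x))); last first.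
    apply/funext => q; rewrite fct_sumE /=.
    rewrite {1}[c _](row_sum_delta (c _ : 'rV[R]_k)) linear_sum.
    by apply: eq_bigr => j _; rewrite linearZ.
  apply: derivable_sum => j; apply: derivableM.
    exact: (smooth_fun_derivable (v := v) (smooth_coord j sc)).
  exact: (smooth_fun_derivable (v := v) (smu _)).
apply: (first_order_operatorE (n := k)
  (D := fun c => mderive (fun y => mu y (c y) : R^o) x v)
  (symb := mu x)) => // [c d sc sd|f e sf].
  rewrite -[RHS]deriveD; [|exact: dmu|exact: dmu].
  rewrite /mderive; apply: (congr1 (fun F => derive F _ _)).
  by apply/funext => q /=; rewrite linearD.
rewrite /mderive.
rewrite (_ : _ \o _ = (f \o chart_inv (chart_at x) : _ -> R) *
   ((fun y => mu y e : R) \o chart_inv (chart_at x))); last first.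
  by apply/funext => q /=; rewrite linearZ.
rewrite deriveM; [|exact: (smooth_fun_derivable (v := v) sf)|
  exact: (smooth_fun_derivable (v := v) (smu e))].
by rewrite /= chart_at_inv [_ *: 'D_v (f \o _) _]mulrC.
Qed.

(** For fixed c, d |-> [c, d](x) obeys the Leibniz rule with symbol the identity
    and v = rho(c) at x. This freezes the second argument; antisymmetry then
    allows the first to be frozen too. *)
Lemma action_algebroid_bracketE br (a b : M -> lie_algebra G) (x : M) :
  action_algebroid_bracket act br -> smooth_fun a -> smooth_fun b ->
  br a b x = lie_algebra_bracket (a x) (b x)
    + mderive b x (anchor act a x) - mderive a x (anchor act b x).
Proof.
move=> Hbr.
have brl (c d : M -> lie_algebra G) : smooth_fun c -> smooth_fun d ->
    br c d x = br c (cst (d x)) x + mderive d x (anchor act c x).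
  move=> sc; apply: (first_order_operatorE (n := k) (D := fun d => br c d x)
    (symb := idfun)) => [d1 d2 s1 s2|f e sf].
    by rewrite (algebroid_add Hbr).
  by rewrite (algebroid_leibniz Hbr sf sc (smooth_fun_cst e)).
move=> sa sb; rewrite brl //.
have scb : smooth_fun (cst (b x) : M -> lie_algebra G) by exact: smooth_fun_cst.
have sca : smooth_fun (cst (a x) : M -> lie_algebra G) by exact: smooth_fun_cst.
rewrite (algebroid_skew Hbr sa scb) /= brl // opprD.
rewrite -[- br _ _ x](congr1 (fun F => F x) (algebroid_skew Hbr sca scb)).
by rewrite (algebroid_cst Hbr) addrAC.
Qed.

End ActionAlgebroid.

Theorem proposition4p5 (R : realType) (m k : nat) (M : manifoldType R m)
    (omega : form2 M) (G : lieGroupType R k) (act : G -> M -> M)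
    (mu : M -> {scalar (lie_algebra G)})
    (br : (M -> lie_algebra G) -> (M -> lie_algebra G) -> M -> lie_algebra G) :
  symplectic omega ->
  smooth_action act ->
  momentum_map omega act mu ->
  action_algebroid_bracket act br ->
  compatible_form1 act br omega mu.
Proof.
move=> [omega_form _ _] _ [smu dmu equiv] Hbr.
split=> // a b sa sb x.
rewrite /algebroid_diff1 /iota_rho2 (action_algebroid_bracketE x Hbr) //.
rewrite (form2_skew (anchor act b x) (anchor act a x) omega_form) opprK.
rewrite (mderive_pairing _ smu sb) (mderive_pairing _ smu sa).
rewrite [mu x (_ - _)]linearB [mu x (_ + _)]linearD /=.
(* Equivariance is spent on the first derivative only: it cancels the bracket
   term. The Hamiltonian condition, spent on the second, leaves omega. *)
rewrite /anchor equiv dmu.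
have cancel_terms (p q r o : R) : p + q - (- o + r) - (p + q - r) = o by ring.
exact: cancel_terms.
Qed.
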